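(* Let $A\in\mathbb{R}$ and define $\mathcal H:W^{1,4}_{\rm per}(\Omega)\to\mathbb{R}$ by $$\mathcal H(\phi)=\int_\Omega\left(A\,(\phi^4+|\nabla\phi|^4)+3\phi^2|\nabla\phi|^2\right)d\mathbf x .$$ If $A\ge1$, then $\mathcal H$ is convex.
   Context: $\Omega\subset\mathbb{R}^D$, $D=2$ or $3$, is a rectangular box, and $W^{1,4}_{\rm per}(\Omega)$ is the Sobolev space of real-valued $\Omega$-periodic functions. *)

(* Defs.v *)
From HB Require Import structures.
From mathcomp Require Import all_boot all_order all_algebra.
From mathcomp Require Import interval_inference.
From mathcomp Require Import all_classical all_reals all_analysis.

Set Implicit Arguments.
Unset Strict Implicit.
Unset Printing Implicit Defensive.
Import Order.TTheory GRing.Theory Num.Theory.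
Import numFieldNormedType.Exports.
Local Open Scope classical_set_scope.
Local Open Scope ring_scope.

Definition rV_display : measure_display. Proof. exact: default_measure_display. Qed.

Section measurable_rV.
Context {R : realType} {n : nat}.

Definition rV_coord (i : 'I_n) (x : 'rV[R]_n) : measurableTypeR R := x ord0 i.

Let rV_set0 : g_sigma_preimage rV_coord set0.
Proof. exact: sigma_algebra0. Qed.

Let rV_setC A : g_sigma_preimage rV_coord A -> g_sigma_preimage rV_coord (~` A).
Proof. exact: sigma_algebraC. Qed.

Let rV_bigcup (F : _^nat) : (forall i, g_sigma_preimage rV_coord (F i)) ->
  g_sigma_preimage rV_coord (\bigcup_i (F i)).
Proof. exact: sigma_algebra_bigcup. Qed.

(* The product sigma-algebra, which on R^n is the Borel one. *)
HB.instance Definition _ := @isMeasurable.Build rV_display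
  'rV[R]_n (g_sigma_preimage rV_coord) rV_set0 rV_setC rV_bigcup.

Lemma measurable_rV_coord (i : 'I_n) : measurable_fun setT (rV_coord i).
Proof.
move=> _ Y mY; rewrite setTI; apply: sub_sigma_algebra => /=.
rewrite -bigcup_seq/=; exists i => /=; first by rewrite mem_index_enum.
by exists Y => //; rewrite setTI.
Qed.

Lemma measurable_fun_rVP d (T : measurableType d) (f : T -> 'rV[R]_n) :
  (forall i, measurable_fun setT (rV_coord i \o f)) -> measurable_fun setT f.
Proof.
move=> mf _ A mA; rewrite setTI.
have : g_sigma_preimage (fun i => rV_coord i \o f) (f @^-1` A).
  by rewrite g_sigma_preimage_comp; exists A => //; rewrite setTI.
apply: smallest_sub; first exact: sigma_algebra_measurable.
rewrite -bigcup_seq => B [i _] [C mC <-]; exact: mf.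
Qed.

End measurable_rV.

Section lebesgue_rV.
Context {R : realType}.

Definition rV_cons n (p : measurableTypeR R * 'rV[R]_n) : 'rV[R]_n.+1 :=
  row_mx (const_mx p.1 : 'rV[R]_1) p.2.

Lemma rV_cons0 n p : @rV_cons n p ord0 ord0 = p.1.
Proof. by rewrite mxE; case: splitP => // j _; rewrite mxE. Qed.

Lemma rV_consS n p i : @rV_cons n p ord0 (lift ord0 i) = p.2 ord0 i.
Proof.
rewrite mxE; case: splitP => [j|k] /=; first by rewrite (ord1 j).
by rewrite /bump/= !add1n => -[/ord_inj ->].
Qed.

Lemma measurable_rV_cons n : measurable_fun setT (@rV_cons n).
Proof.
apply: measurable_fun_rVP => i; case: (unliftP ord0 i) => [j|] ->.
  rewrite (_ : _ \o _ = rV_coord j \o snd).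
    exact: measurableT_comp (measurable_rV_coord j) measurable_snd.
  by apply/funext => p; rewrite /= /rV_coord rV_consS.
rewrite (_ : _ \o _ = fst); first exact: measurable_fst.
by apply/funext => p; rewrite /= /rV_coord rV_cons0.
Qed.

HB.instance Definition _ n :=
  isMeasurableFun.Build _ _ _ _ (@rV_cons n) (@measurable_rV_cons n).

Definition rV_uncons n (x : 'rV[R]_n.+1) : measurableTypeR R * 'rV[R]_n :=
  (x ord0 ord0, \row_i x ord0 (lift ord0 i)).

Lemma rV_consK n : cancel (@rV_cons n) (@rV_uncons n).
Proof.
move=> [t v]; rewrite /rV_uncons rV_cons0; congr pair.
by apply/rowP => i; rewrite mxE rV_consS.
Qed.

Lemma rV_unconsK n : cancel (@rV_uncons n) (@rV_cons n).
Proof.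
move=> x; apply/rowP => i.
case: (unliftP ord0 i) => [j|] ->; first by rewrite rV_consS mxE.
by rewrite rV_cons0.
Qed.

Lemma measurable_rV_uncons n : measurable_fun setT (@rV_uncons n).
Proof.
apply/measurable_fun_pairP; split; first exact: (measurable_rV_coord ord0).
apply: measurable_fun_rVP => i.
rewrite (_ : _ \o _ = rV_coord (lift ord0 i)).
  exact: measurable_rV_coord.
by apply/funext => x; rewrite /= /rV_coord mxE.
Qed.

Section cons_measure.
Variables (n : nat) (mu : {sigma_finite_measure set 'rV[R]_n -> \bar R}).

Definition cons_measure : set 'rV[R]_n.+1 -> \bar R :=
  pushforward (@lebesgue_measure R \x mu)%E (@rV_cons n).

Let cons_measure0 : cons_measure set0 = 0%E.
Proof. exact: measure0. Qed.

Let cons_measure_ge0 A : (0 <= cons_measure A)%E.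
Proof. exact: measure_ge0. Qed.

Let cons_measure_sigma_additive : semi_sigma_additive cons_measure.
Proof. exact: measure_semi_sigma_additive. Qed.

HB.instance Definition _ := isMeasure.Build _ _ _ cons_measure
  cons_measure0 cons_measure_ge0 cons_measure_sigma_additive.

Let cons_measure_sigma_finite : sigma_finite setT cons_measure.
Proof.
have /sigma_finiteP[F [FT ndF Foo]] := sigma_finiteT (@lebesgue_measure R).
have /sigma_finiteP[G [GT ndG Goo]] := sigma_finiteT mu.
exists (fun k => @rV_uncons n @^-1` (F k `*` G k)).
  apply/esym; rewrite -subTset => x _.
  have [k _ Fk] : (\bigcup_i F i) (rV_uncons x).1 by rewrite -FT.
  have [l _ Gl] : (\bigcup_i G i) (rV_uncons x).2 by rewrite -GT.
  exists (maxn k l) => //; split.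
    by move: Fk; exact/subsetPset/ndF/leq_maxl.
  by move: Gl; exact/subsetPset/ndG/leq_maxr.
move=> k; have [mF Fk] := Foo k; have [mG Gk] := Goo k; split.
  rewrite -[X in measurable X]setTI.
  by apply: measurable_rV_uncons => //; exact: measurableX.
rewrite /cons_measure /pushforward -comp_preimage.
rewrite (_ : _ \o _ = id); last by apply/funext => p /=; rewrite rV_consK.
by rewrite preimage_id product_measure1E// lte_mul_pinfty// ge0_fin_numE.
Qed.

HB.instance Definition _ := Measure_isSigmaFinite.Build _ _ _ cons_measure
  cons_measure_sigma_finite.

End cons_measure.

(* Lebesgue measure on R^n, as the n-fold product of the one on R. *)
Fixpoint lebesgue_rV n : {sigma_finite_measure set 'rV[R]_n -> \bar R} :=
  if n is m.+1 then cons_measure (lebesgue_rV m) else \d_(0 : 'rV[R]_0).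

End lebesgue_rV.

Definition box {R : realType} {n} (a b : 'rV[R]_n) : set 'rV[R]_n :=
  [set x | forall i, a ord0 i < x ord0 i < b ord0 i].

Lemma measurable_box {R : realType} n (a b : 'rV[R]_n) : measurable (box a b).
Proof.
rewrite (_ : box a b = \bigcap_(i in [set: 'I_n])
    (rV_coord i @^-1` `]a ord0 i, b ord0 i[%classic)); last first.
  apply/seteqP; split=> x h i; have := h i; rewrite /= in_itv/=; first by [].
  exact.
apply: fin_bigcap_measurable => // i _; rewrite -[X in measurable X]setTI.
by apply: measurable_rV_coord => //; exact: measurable_itv.
Qed.

Lemma lebesgue_rV_box {R : realType} n (a b : 'rV[R]_n) :
  (forall i, a ord0 i <= b ord0 i) ->
  lebesgue_rV n (box a b) = (\prod_(i < n) (b ord0 i - a ord0 i))%:E.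
Proof.
elim: n a b => [|n IH] a b ab /=.
  rewrite big_ord0 diracE mem_set//; by case.
rewrite /cons_measure /pushforward.
rewrite (_ : _ @^-1` _ = `]a ord0 ord0, b ord0 ord0[%classic `*`
    box (rV_uncons a).2 (rV_uncons b).2); last first.
  apply/seteqP; split=> -[t v] /=.
    move=> h; split=> [|i]; first by have := h ord0; rewrite rV_cons0 in_itv.
    by have := h (lift ord0 i); rewrite rV_consS !mxE.
  rewrite in_itv/= => -[h0 h] i.
  case: (unliftP ord0 i) => [j|] ->; last by rewrite rV_cons0.
  by have := h j; rewrite rV_consS !mxE.
rewrite product_measure1E//; last exact: measurable_box.
rewrite IH; last by move=> i; rewrite !mxE.
rewrite -[X in (X * _)%E = _]/(lebesgue_measure `]a ord0 ord0, b ord0 ord0[%classic).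
rewrite lebesgue_measure_itv/= lte_fin big_ord_recl EFinM.
rewrite (_ : (if _ then _ else _) = (b ord0 ord0 - a ord0 ord0)%:E); last first.
  case: ltP => // h; have := ab ord0 => h1.
  by rewrite (@le_anti _ _ (a ord0 ord0) (b ord0 ord0)) ?subrr// h1.
congr (_ * _%:E)%E.
by apply: eq_bigr => i _; rewrite !mxE.
Qed.

Section sobolev.
Context {R : realType} {n : nat}.
Local Notation mu := (@lebesgue_rV R n).
Implicit Types (u psi : 'rV[R]_n -> R^o) (g : 'rV[R]_n -> 'rV[R]_n).
Implicit Types a b : 'rV[R]_n.

Definition partial (i : 'I_n) u : 'rV[R]_n -> R^o := 'D_(delta_mx ord0 i) u.

Definition smooth u := forall (s : seq 'I_n) x, differentiable (foldr partial u s) x.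

Definition compactly_supported u := exists M : R, forall x, M < `|x| -> u x = 0.

Definition Lploc (p : nat) (f : 'rV[R]_n -> R) :=
  measurable_fun setT f /\
  forall a b, (\int[mu]_(x in box a b) (`|f x| ^+ p)%:E < +oo)%E.

Definition weak_gradient u g :=
  (forall i, Lploc 1 (fun x => g x ord0 i)) /\
  forall psi, smooth psi -> compactly_supported psi ->
  forall i, \int[mu]_x (u x * partial i psi x) = - \int[mu]_x (g x ord0 i * psi x).

(* The weak gradient of u, unique up to a null set when it exists. *)
Definition grad u : 'rV[R]_n -> 'rV[R]_n := xget (cst 0) [set g | weak_gradient u g].

Definition box_periodic a b u :=
  forall (i : 'I_n) x, u (x + (b ord0 i - a ord0 i) *: delta_mx ord0 i) = u x.

(* W^{1,p}_per(box a b): functions of W^{1,p}_loc(R^n) periodic along each axis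
   with the corresponding side of the box as period; elements are represented by
   functions, not by classes modulo a.e. equality. *)
Definition W1p_per (p : nat) a b : set ('rV[R]_n -> R^o) :=
  [set u | [/\ box_periodic a b u, Lploc p u &
    exists2 g, weak_gradient u g & forall i, Lploc p (fun x => g x ord0 i)]].

(* Euclidean norm: the library norm `|v| on row vectors is the sup norm. *)
Definition enorm (v : 'rV[R]_n) : R := Num.sqrt (\sum_(i < n) v ord0 i ^+ 2).

Definition calH (A : R) a b u : R :=
  \int[mu]_(x in box a b)
    (A * (u x ^+ 4 + enorm (grad u x) ^+ 4) + 3 * u x ^+ 2 * enorm (grad u x) ^+ 2).

End sobolev.

(* Main.v *)
(* On a pair (s, r) with r >= 0 the integrand A (s^4 + r^4) + 3 s^2 r^2 is convex,
   being a nonnegative combination of fourth powers of linear forms, and it is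
   nondecreasing in r; composed with the convex function |.| it is therefore
   convex in (phi, grad phi), and convexity of the integral follows once
   grad (t u + (1 - t) v) = t grad u + (1 - t) grad v almost everywhere.
   Since grad is a choice of weak gradient, the latter requires uniqueness of weak
   gradients, i.e. the fundamental lemma of the calculus of variations: if a locally
   integrable f is orthogonal to all test functions then, the indicator of an open
   box being a bounded pointwise limit of explicit test functions (products of
   exp (- 1 / (k (x_i - a_i))) and exp (- 1 / (k (b_i - x_i)))), f has integral 0
   on every box, hence on every measurable subset of a box (Dynkin), so f = 0
   almost everywhere. *)
Require Import Defs.
From mathcomp Require Import all_boot all_order all_algebra.
From mathcomp Require Import interval_inference.
From mathcomp Require Import all_classical all_reals all_analysis.
From mathcomp Require Import measurable_realfun ring lra.

Set Implicit Arguments.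
Unset Strict Implicit.
Unset Printing Implicit Defensive.
Import Order.TTheory GRing.Theory Num.Theory.
Import numFieldNormedType.Exports.
Local Open Scope classical_set_scope.
Local Open Scope ring_scope.

(** * A smooth function vanishing on the nonpositive half-line *)

Section flat.
Context {R : realType}.
Implicit Types (m : nat) (t : R).

(** The index [m] makes the family closed under differentiation: the derivative of a member is a
    combination of members of higher index. *)
Definition flat m t : R := if 0 < t then t^-1 ^+ m * expR (- t^-1) else 0.

Lemma flat0 m t : t <= 0 -> flat m t = 0.
Proof. by rewrite /flat ltNge => ->. Qed.

(** With [y = 1/t > 0], the exponential series gives [y^(m+1) / (m+1)! <= exp y], so
    [y^m exp (-y) <= (m+1)! / y]. This decay settles the derivative at 0. *)
Lemma flat_le m t : `|flat m t| <= m.+1`!%:R * `|t|.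
Proof.
have [t0|t0] := leP t 0; first by rewrite flat0// normr0 mulr_ge0.
have y0 : 0 < t^-1 by rewrite invr_gt0.
rewrite /flat t0 expRN ger0_norm; last first.
  by rewrite mulr_ge0 ?invr_ge0 ?expR_ge0 ?exprn_ge0// ltW.
rewrite gtr0_norm// ler_pdivrMr ?expR_gt0//.
have f0 : 0 < m.+1`!%:R :> R by rewrite ltr0n fact_gt0.
have : t^-1 ^+ m.+1 / m.+1`!%:R <= expR t^-1.
  by apply: le_trans (expR_ge1Dxn m (ltW y0)); rewrite lerDr.
rewrite ler_pdivrMr// exprS => h.
by rewrite mulrAC -ler_pdivrMr// mulrC [leRHS]mulrC.
Qed.

Lemma is_derive_flat m t :
  is_derive (t : R^o) (1 : R^o) (flat m : R^o -> R^o) (flat m.+2 t - m%:R * flat m.+1 t).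
Proof.
have [t0|t0|->] := ltgtP t 0.
- rewrite !flat0 ?ltW// mulr0 subr0.
  apply: (near_eq_is_derive _ (is_derive_cst (0 : R^o) (t : R^o) (1 : R^o))).
  near=> x; rewrite flat0//; near: x; exact: lt_le_nbhsl.
- have n0 : t != 0 by rewrite gt_eqF.
  have dV := @is_deriveV R id t 1 1 n0 (is_derive_id _ _).
  have dX := is_deriveX m dV.
  have dE := is_derive1_comp (is_derive_expR _) (is_deriveN dV).
  have dM := is_deriveM dX dE.
  apply: (near_eq_is_derive _ (is_derive_eq dM _)).
    near=> x; rewrite /flat ifT//.
      by rewrite mulrfctE exprfctE.
    by near: x; exact: lt_nbhsr.
  rewrite /flat t0 /= exprfctE /GRing.scale/= !mulr1 -[(- _) t]/(- t^-1).
  (* The derivative of the power involves the predecessor of [m], so [m = 0] is treated apart. *)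
  case: m {dX dM} => [|m]; rewrite !exprS/=; by field.
- rewrite !flat0// mulr0 subr0.
  (* At 0 the difference quotient of [flat m] is [flat m.+1], which [flat_le] bounds by
     [(m+2)! |h|]. *)
  have lim0 : (fun h : R^o =>
      h^-1 *: (((flat m : R^o -> R^o) \o shift (0 : R^o)) (h *: (1 : R^o)) -
               flat m (0 : R) : R^o)) @ 0^' --> (0 : R^o).
    apply/cvgr0Pnorm_lt => /= e e0.
    have M0 : 0 < m.+2`!%:R :> R by rewrite ltr0n fact_gt0.
    near=> h.
    rewrite (flat0 m (lexx _)) subr0 /= addr0 [h *: 1]mulr1.
    rewrite (_ : h^-1 *: flat m h = flat m.+1 h); last first.
      rewrite /flat; case: ifP => h0; last by rewrite scaler0.
      by rewrite /GRing.scale/= exprS mulrA.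
    apply: (le_lt_trans (flat_le _ _)).
    rewrite -ltr_pdivlMl//; near: h.
    by apply: dnbhs0_lt; rewrite mulr_gt0// invr_gt0.
  apply: DeriveDef; first by apply/cvg_ex; exists 0.
  exact/cvg_lim.
Unshelve. all: by end_near. Qed.
End flat.

(** * Bump functions *)

Section bump.
Context {R : realType} {n : nat}.
Implicit Types (m : nat) (x v : 'rV[R]_n).

Lemma is_derive_coord (i : 'I_n) x v :
  is_derive x v (fun y : 'rV[R]_n => y ord0 i : R^o) (v ord0 i).
Proof.
have df := differentiable_coord x ord0 i.
apply: DeriveDef; first exact: diff_derivable.
apply/cvg_lim => //; apply: (@cvg_trans _ ((cst (v ord0 i : R^o)) @ 0^')); last exact: cvg_cst.
apply: near_eq_cvg; near=> h.
have h0 : h != 0 by near: h; exact: nbhs_dnbhs_neq.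
by rewrite /= !mxE addrK /GRing.scale/= mulKf.
Unshelve. all: by end_near. Qed.

Lemma chain_rule (f : 'rV[R]_n -> R^o) (g : R^o -> R^o) x v (df dg : R) :
  differentiable f x -> is_derive x v f df ->
  is_derive (f x) (1 : R^o) g dg ->
  differentiable (g \o f) x /\ is_derive x v (g \o f) (dg * df).
Proof.
move=> dif isf isg.
have dig : differentiable g (f x) by apply/derivable1_diffP; case: isg.
have di : differentiable (g \o f) x by exact: differentiable_comp.
split => //; apply: DeriveDef; first exact: diff_derivable.
rewrite deriveE// diff_comp//= diff1E//= -deriveE//.
by rewrite !derive1E (@derive_val _ _ _ _ _ _ _ isg) (@derive_val _ _ _ _ _ _ _ isf) mulrC.
Qed.

(* Algebra generated by the functions x |-> flat m (k x_i + c): it is stable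
   under partial derivatives, so all of its members are smooth. *)
Inductive flat_algebra : ('rV[R]_n -> R^o) -> Prop :=
| flat_algebra_cst c : flat_algebra (cst c)
| flat_algebra_flat m i (k c : R) :
    flat_algebra (fun x => flat m (k * x ord0 i + c))
| flat_algebraD f g : flat_algebra f -> flat_algebra g -> flat_algebra (f + g)
| flat_algebraM f g : flat_algebra f -> flat_algebra g -> flat_algebra (f * g).

Lemma flat_algebra_derive f : flat_algebra f ->
  (forall x, differentiable f x) /\ (forall j, flat_algebra (partial j f)).
Proof.
elim=> {f} [c|m i k c|f g _ [df pf] _ [dg pg]|f g Ff [df pf] Fg [dg pg]].
- split=> [x|j]; first exact: differentiable_cst.
  rewrite (_ : partial _ _ = cst 0); first exact: flat_algebra_cst.
  by apply/funext => x; rewrite /partial derive_cst.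
- have da x j : differentiable (fun x : 'rV[R]_n => k * x ord0 i + c : R^o) x /\
      is_derive x (delta_mx ord0 j)
        (fun x : 'rV[R]_n => k * x ord0 i + c : R^o) (k * (i == j)%:R).
    split.
      apply: differentiableD; last exact: differentiable_cst.
      apply: differentiableM; first exact: differentiable_cst.
      exact: differentiable_coord.
    apply: (is_derive_eq (is_deriveD
      (is_deriveZ k (is_derive_coord i x (delta_mx ord0 j)))
      (is_derive_cst (c : R^o) x (delta_mx ord0 j)))).
    by rewrite addr0 mxE eqxx.
  split=> [x|j].
    have [d1 d2] := da x i.
    by have [] := chain_rule d1 d2 (is_derive_flat m (k * x ord0 i + c)).
  rewrite (_ : partial _ _ =
    (fun x => flat m.+2 (k * x ord0 i + c)) * cst (k * (i == j)%:R) +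
    (cst (- m%:R) * (fun x => flat m.+1 (k * x ord0 i + c))) * cst (k * (i == j)%:R)).
    apply: flat_algebraD; apply: flat_algebraM; try apply: flat_algebraM;
    by [exact: flat_algebra_cst|exact: flat_algebra_flat].
  apply/funext => x; have [d1 d2] := da x j.
  have [_ d3] := chain_rule d1 d2 (is_derive_flat m (k * x ord0 i + c)).
  rewrite /partial (@derive_val _ _ _ _ _ _ _ d3) mulrBl.
  by rewrite -mulNr -mulNr.
- split=> [x|j]; first exact: differentiableD.
  rewrite (_ : partial _ _ = partial j f + partial j g); first exact: flat_algebraD.
  by apply/funext => x; rewrite /partial deriveD//; exact: diff_derivable.
- split=> [x|j]; first exact: differentiableM.
  rewrite (_ : partial _ _ = f * partial j g + g * partial j f).
    by apply: flat_algebraD; apply: flat_algebraM.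
  by apply/funext => x; rewrite /partial deriveM//; exact: diff_derivable.
Qed.

Lemma flat_algebra_smooth f : flat_algebra f -> smooth f.
Proof.
move=> Ff s; suff : flat_algebra (foldr (@partial R n) f s).
  by case/flat_algebra_derive.
by elim: s => //= j s /flat_algebra_derive[].
Qed.

Definition bump (a b : 'rV[R]_n) (k : R) : 'rV[R]_n -> R^o := fun x =>
  \prod_(i < n) (flat 0 (k * (x ord0 i - a ord0 i)) * flat 0 (k * (b ord0 i - x ord0 i))).

Lemma bump_smooth a b k : smooth (bump a b k).
Proof.
apply: flat_algebra_smooth.
rewrite (_ : bump a b k = \prod_(i < n)
  ((fun x => flat 0 (k * x ord0 i + - (k * a ord0 i))) *
   (fun x => flat 0 (- k * x ord0 i + k * b ord0 i)))).
  elim/big_rec: _ => [|i f _ Ff]; first exact: flat_algebra_cst.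
  by apply: flat_algebraM => //; apply: flat_algebraM; exact: flat_algebra_flat.
apply/funext => x; rewrite fct_prodE; apply: eq_bigr => i _.
by rewrite mulrfctE !mulrBr mulNr [- _ + _]addrC.
Qed.

Lemma flat0_itv (t : R) : 0 <= flat 0 t <= 1.
Proof.
rewrite /flat; case: ifP => [t0|_]; last by rewrite lexx ler01.
by rewrite expr0 mul1r expR_ge0 expR_le1 oppr_le0 invr_ge0 ltW.
Qed.

Lemma bump_itv a b k x : 0 <= bump a b k x <= 1.
Proof.
apply/andP; split; [apply: prodr_ge0|apply: prodr_ile1] => i _;
  have /andP[? ?] := flat0_itv (k * (x ord0 i - a ord0 i));
  have /andP[? ?] := flat0_itv (k * (b ord0 i - x ord0 i)).
- exact: mulr_ge0.
- by rewrite mulr_ge0//= mulr_ile1.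
Qed.

Lemma bump_out a b k x : 0 < k -> ~ box a b x -> bump a b k x = 0.
Proof.
move=> k0 /existsNP[i /negP]; rewrite negb_and -!leNgt => h.
rewrite /bump (bigD1 i)//=; case/orP: h => h.
  by rewrite flat0 ?mul0r// pmulr_rle0// subr_le0.
by rewrite (@flat0 _ _ (k * (b _ _ - _))) ?mulr0 ?mul0r// pmulr_rle0// subr_le0.
Qed.

(** For [t > 0], [flat 0 (k t) = exp (- 1 / (k t))] has an exponent tending to 0, so every factor of
    the finite product tends to 1. Writing the scale as [k.+1] keeps it positive. *)
Lemma bump_in a b x : box a b x -> bump a b k.+1%:R x @[k --> \oo] --> (1 : R).
Proof.
move=> xab.
have flat1 t : 0 < t -> flat 0 (k.+1%:R * t) @[k --> \oo] --> (1 : R).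
  move=> t0.
  have -> : (fun k => flat 0 (k.+1%:R * t)) = (fun k => expR (- (t^-1 * (k.+1%:R)^-1))).
    apply/funext => k; rewrite /flat mulr_gt0// expr0 mul1r.
    by rewrite invfM mulrC.
  have h0 : (k.+1%:R^-1 : R) @[k --> \oo] --> (0 : R) := @cvg_harmonic R.
  have h1 : - (t^-1 * (k.+1%:R)^-1) @[k --> \oo] --> - (t^-1 * 0).
    by apply: cvgN; exact: cvgMl_tmp h0.
  have h2 := continuous_cvg _ (@continuous_expR R _) h1.
  by move: h2; rewrite mulr0 oppr0 expR0; apply.
rewrite /bump.
rewrite -[X in _ --> X](_ : \prod_(i < n) (1 * 1) = 1); last first.
  by rewrite big1// => i _; rewrite mul1r.
apply: cvg_big => [|i _]; first exact: mul_continuous.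
have /andP[h1 h2] := xab i.
by apply: cvgM; apply: flat1; rewrite subr_gt0.
Qed.

Lemma mx_norm_rVP x (M : R) : 0 <= M ->
  `|x| <= M <-> forall i, `|x ord0 i| <= M.
Proof.
move=> M0; rewrite [`|x|]mx_normrE; split=> [h i|h].
  exact: le_trans (le_bigmax _ (fun ij => `|x ij.1 ij.2|) (ord0, i)) h.
by apply/bigmax_leP; split=> // -[i j] _ /=; rewrite ord1.
Qed.

Lemma box_bounded a b x : box a b x -> `|x| <= `|a| + `|b|.
Proof.
move=> xab; apply/mx_norm_rVP => [|i]; first exact: addr_ge0.
have /andP[/ltW h1 /ltW h2] := xab i.
have [/(_ (lexx _))/(_ i) ha _] := mx_norm_rVP a (normr_ge0 a).
have [/(_ (lexx _))/(_ i) hb _] := mx_norm_rVP b (normr_ge0 b).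
move: ha hb; rewrite !ler_norml => /andP[? ?] /andP[? ?].
have ? := normr_ge0 a; have ? := normr_ge0 b; lra.
Qed.

Lemma bump_compactly_supported a b k : 0 < k -> compactly_supported (bump a b k).
Proof.
move=> k0; exists (`|a| + `|b|) => x xab; apply: bump_out => // /box_bounded.
by rewrite leNgt xab.
Qed.

End bump.

(** * Boxes generate the measurable sets *)

Section boxes.
Context {R : realType} {n : nat}.
Implicit Types (x a b : 'rV[R]_n).

Definition boxes : set (set 'rV[R]_n) := [set B | exists a b, B = box a b].

Lemma boxes_setI : setI_closed boxes.
Proof.
move=> _ _ [a [b ->]] [c [d ->]].
exists (\row_i Num.max (a ord0 i) (c ord0 i)), (\row_i Num.min (b ord0 i) (d ord0 i)).
apply/seteqP; split=> x /=.
  move=> [h1 h2] i; rewrite !mxE gt_max lt_min.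
  by case/andP: (h1 i) => -> ->; case/andP: (h2 i) => -> ->.
move=> h; split=> i; have := h i; rewrite !mxE gt_max lt_min.
  by case/andP => /andP[-> _] /andP[-> _].
by case/andP => /andP[_ ->] /andP[_ ->].
Qed.

(** The coordinates generate the sigma-algebra, so each only has to be measurable for the one
    generated by boxes. The preimage of a ray []t, +oo[] is a countable union of boxes, bounded
    below by [t] in that coordinate and growing with [k] in all other directions. *)
Lemma measurable_boxesE : @measurable _ 'rV[R]_n = <<s boxes >>.
Proof.
apply/seteqP; split; last first.
  apply: smallest_sub; first exact: sigma_algebra_measurable.
  by move=> _ [a [b ->]]; exact: measurable_box.
apply: smallest_sub; first exact: smallest_sigma_algebra.
rewrite -bigcup_seq => B [i _] [C mC <-]; rewrite setTI.
pose f : g_sigma_algebraType boxes -> measurableTypeR R := fun x => x ord0 i.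
suff mf : measurable_fun setT f by have := mf measurableT _ mC; rewrite setTI.
apply: (measurability _ (RGenOInfty.measurableE R)) => _ [_ [t ->] <-].
rewrite setTI (_ : _ @^-1` _ = \bigcup_k box
    (\row_j if j == i then t else - k%:R) (const_mx k%:R)).
  by apply: bigcupT_measurable => k; apply: sub_sigma_algebra; do 2 eexists.
apply/seteqP; split => x /=; rewrite in_itv/= andbT; last first.
  by move=> [k _ /(_ i)]; rewrite !mxE eqxx => /andP[].
move=> tx; exists (Num.trunc `|x : 'rV[R]_n|).+1 => // j; rewrite !mxE.
have xk : `|x : 'rV[R]_n| < (Num.trunc `|x : 'rV[R]_n|).+1%:R by exact: truncnS_gt.
have [/(_ (lexx _))/(_ j) h _] := mx_norm_rVP (x : 'rV[R]_n) (normr_ge0 (x : 'rV[R]_n)).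
have := le_lt_trans h xk; rewrite ltr_norml => /andP[h1 h2].
by rewrite h2 andbT; case: eqP => [->|].
Qed.

(** An open set is the union of the boxes with rational corners that it contains, and these are
    countably many. *)
Lemma open_measurable_rV (U : set 'rV[R]_n) : open U -> measurable U.
Proof.
move=> oU.
pose q2r (q : 'rV[rat]_n) : 'rV[R]_n := map_mx ratr q.
pose F (p : 'rV[rat]_n * 'rV[rat]_n) :=
  if `[< box (q2r p.1) (q2r p.2) `<=` U >] then box (q2r p.1) (q2r p.2) else set0.
suff -> : U = \bigcup_p F p.
  apply: countable_bigcupT_measurable => // p.
  by rewrite /F; case: ifP => // _; exact: measurable_box.
apply/seteqP; split; last first.
  by move=> x [p _]; rewrite /F; case: asboolP => // h; exact: h.
move=> x Ux; have /nbhs_ballP[e /= e0 eU] := open_nbhs_nbhs (conj oU Ux).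
(* Rational bounds on either side of [x], within [e] in each coordinate: the resulting box lies in
   the sup-norm ball of radius [e]. *)
have h i : { p : rat * rat |
    x ord0 i - e < ratr p.1 < x ord0 i /\ x ord0 i < ratr p.2 < x ord0 i + e }.
  apply: cid.
  have [p] : exists q : rat, ratr q \in `]x ord0 i - e, x ord0 i[.
    by apply: rat_in_itvoo; rewrite ltrBlDr ltrDl.
  rewrite in_itv/= => hp.
  have [q] : exists q : rat, ratr q \in `]x ord0 i, x ord0 i + e[.
    by apply: rat_in_itvoo; rewrite ltrDl.
  by rewrite in_itv/= => hq; exists (p, q).
exists (\row_i (sval (h i)).1, \row_i (sval (h i)).2) => //; rewrite /F /=.
case: asboolP => [_|[]] /=.
  by move=> i; rewrite !mxE; case: (h i) => p /= [/andP[_ ->] /andP[-> _]].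
move=> y yh; apply: eU; split=> // i j; rewrite (ord1 i).
have := yh j; rewrite !mxE; case: (h j) => p /= [/andP[h1 h2] /andP[h3 h4]] /andP[h5 h6].
rewrite /ball/= ltr_norml; lra.
Qed.

Lemma continuous_measurable_rV (f : 'rV[R]_n -> R) :
  continuous f -> measurable_fun setT f.
Proof.
move=> /continuousP cf; apply: (measurability _ (RGenOpens.measurableE R)).
move=> _ [_ [a [b ->]] <-]; rewrite setTI; apply: open_measurable_rV.
exact/cf/interval_open.
Qed.

Lemma compactly_supported_bounded (f : 'rV[R]_n -> R^o) :
  continuous f -> compactly_supported f -> exists M : R, forall x, `|f x| <= M.
Proof.
move=> cf [M fM].
pose K := [set x : 'rV[R]_n | `|x| <= M].
have cK : compact K.
  apply: bounded_closed_compact.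
    exists M; split; first exact: num_real.
    by move=> N MN x /= xM; apply: le_trans xM _; exact: ltW.
  have -> : K = (@Num.norm _ _) @^-1` [set t | t <= M] by [].
  apply: closed_comp; last exact: closed_le.
  by move=> x _; exact: norm_continuous.
have [N [Nr hN]] := compact_bounded (continuous_compact (continuous_subspaceT cf) cK).
exists (`|N| + 1) => x.
have [xM|xM] := leP `|x| M; last by rewrite fM// normr0 addr_ge0.
apply: hN; last by exists x.
by rewrite (le_lt_trans (ler_norm _))// ltrDl.
Qed.

End boxes.

(** * Local integrability *)

Section local_integrability.
Context {R : realType} {n : nat}.
Local Notation mu := (@lebesgue_rV R n).
Implicit Types (x a b : 'rV[R]_n) (f psi : 'rV[R]_n -> R^o).

(** For positive [r], the open ball of radius [r] of the sup norm, presented as a box. *)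
Definition cube (r : R) : set 'rV[R]_n := box (const_mx (- r)) (const_mx r).

Lemma cubeP x r : `|x| < r -> cube r x.
Proof.
move=> xr i; rewrite !mxE.
have [/(_ (lexx _))/(_ i) h _] := mx_norm_rVP x (normr_ge0 x).
by rewrite -ltr_norml (le_lt_trans h).
Qed.

Lemma lebesgue_rV_box_lty a b : (mu (box a b) < +oo)%E.
Proof.
have [ab|] := pselect (forall i, a ord0 i <= b ord0 i).
  by rewrite lebesgue_rV_box// ltry.
move=> /existsNP[i /negP]; rewrite -ltNge => ba.
rewrite (_ : box a b = set0) ?measure0//.
apply/seteqP; split => // x /(_ i) /andP[ax xb].
by have := lt_trans ax xb; rewrite ltNge (ltW ba).
Qed.

Lemma Lploc_integrable p f a b : Lploc p f ->
  mu.-integrable (box a b) (fun x => (`|f x| ^+ p)%:E).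
Proof.
move=> [mf fp]; apply/integrableP; split.
  apply/measurable_EFinP; apply: measurable_funX; apply: measurableT_comp => //.
  exact: measurable_funTS.
under eq_integral do rewrite gee0_abs ?lee_fin ?exprn_ge0//.
exact: fp.
Qed.

Lemma LplocP p f : measurable_fun setT f ->
  (forall a b, exists2 g, mu.-integrable (box a b) g &
     forall x, box a b x -> ((`|f x| ^+ p)%:E <= `|g x|)%E) -> Lploc p f.
Proof.
move=> mf h; split=> // a b; have [g gi fg] := h a b.
have [_ foo] := integrableP _ _ _ gi.
apply: le_lt_trans foo; apply: ge0_le_integral => //.
- exact: measurable_box.
- apply/measurable_EFinP; apply: measurable_funX; apply: measurableT_comp => //.
  exact: measurable_funTS.
- by apply: measurableT_comp => //; exact: measurable_int gi.
Qed.

Lemma box_integrable_cst a b (c : R) : mu.-integrable (box a b) (EFin \o cst c).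
Proof.
apply: measurable_bounded_integrable; first exact: measurable_box.
- exact: lebesgue_rV_box_lty.
- exact: measurable_cst.
- by exists `|c|; split; [exact: num_real|move=> M /ltW cM x _].
Qed.

(** Boxes have finite measure and [|f| <= 1 + |f|^(p+1)]. *)
Lemma Lploc_le1 p f : Lploc p.+1 f -> Lploc 1 f.
Proof.
move=> fp; apply: LplocP => [|a b]; first by case: fp.
exists ((EFin \o cst 1%R) \+ (fun x => (`|f x| ^+ p.+1)%:E))%E.
  apply: integrableD; first exact: measurable_box.
    exact: box_integrable_cst.
  exact: Lploc_integrable.
move=> x _; rewrite -EFinD /= lee_fin expr1.
rewrite [leRHS]ger0_norm ?addr_ge0 ?exprn_ge0//.
have [f1|f1] := leP 1 `|f x|.
  by rewrite (le_trans (ler_eXnr (ltn0Sn p) f1))// lerDr.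
by rewrite (le_trans (ltW f1))// lerDl exprn_ge0.
Qed.

Lemma Lploc1_integrable f a b : Lploc 1 f -> mu.-integrable (box a b) (EFin \o f).
Proof.
move=> f1; have [mf _] := f1.
apply: le_integrable (Lploc_integrable a b f1); first exact: measurable_box.
  by apply/measurable_EFinP; exact: measurable_funTS.
by move=> x _; rewrite /= lee_fin expr1 normr_id.
Qed.

Lemma compactly_supported_cube psi : compactly_supported psi ->
  exists r : R, forall x, ~ cube r x -> psi x = 0.
Proof.
move=> [M hM]; exists (M + 1) => x xM; apply: hM; rewrite ltNge.
apply/negP => h; apply: xM; apply: cubeP.
by rewrite (le_lt_trans h)// ltrDl.
Qed.

(** The product vanishes off some cube, and there it is an integrable function times a bounded
    one. *)
Lemma Lploc1_integrableM f psi : Lploc 1 f ->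
  continuous psi -> compactly_supported psi ->
  mu.-integrable setT (EFin \o (fun x => f x * psi x)).
Proof.
move=> f1 cpsi spsi.
have [M hM] := compactly_supported_bounded cpsi spsi.
have [r hr] := compactly_supported_cube spsi.
have mcube : measurable (cube r) by exact: measurable_box.
suff : mu.-integrable (cube r) (EFin \o (fun x => f x * psi x)).
  move/(integrable_mkcond _ mcube); congr integrable; apply/funext => x.
  rewrite patchE; case: ifPn => //; rewrite notin_setE => /hr /= ->.
  by rewrite mulr0.
rewrite (_ : EFin \o _ = (EFin \o f) \* (EFin \o psi))%E; last first.
  by apply/funext => x; rewrite /= EFinM.
apply: integrableMl => //; first exact: Lploc1_integrable.
  by apply: measurable_funTS; exact: continuous_measurable_rV.
exists M; split; first exact: num_real.
by move=> N MN x _ /=; apply: le_trans (hM x) _; exact: ltW.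
Qed.

Lemma smooth_continuous psi : smooth psi -> continuous psi.
Proof. by move=> h x; exact/differentiable_continuous/(h [::]). Qed.

Lemma smooth_partial psi i : smooth psi -> smooth (partial i psi).
Proof. by move=> h s x; have := h (rcons s i) x; rewrite foldr_rcons. Qed.

(** The condition [M < |x|] is open, so [psi] vanishes in a neighbourhood of such an [x]; the same
    [M] serves for the derivative. *)
Lemma compactly_supported_partial psi i :
  compactly_supported psi -> compactly_supported (partial i psi).
Proof.
move=> [M hM]; exists M => x xM.
rewrite /partial (_ : 'D_ _ psi x = 'D_(delta_mx ord0 i) (cst 0 : 'rV[R]_n -> R^o) x).
  by rewrite derive_cst.
apply: near_eq_derive; near=> y; apply: hM; near: y.
exact: (@norm_continuous _ 'rV[R]_n x _ (lt_nbhsr xM)).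
Unshelve. all: by end_near. Qed.

End local_integrability.

(** * The fundamental lemma of the calculus of variations *)

Section fundamental_lemma.
Context {R : realType} {n : nat}.
Local Notation mu := (@lebesgue_rV R n).
Implicit Types (x a b : 'rV[R]_n) (f psi : 'rV[R]_n -> R^o).

(** Dominated convergence on the box with bound [|f|], since bumps take values in [[0, 1]]; they
    vanish off the box, which localises the integrals. *)
Lemma bump_integral_cvg f a b : Lploc 1 f ->
  (\int[mu]_x (f x * bump a b k.+1%:R x)%:E)%E @[k --> \oo] -->
  (\int[mu]_(x in box a b) (f x)%:E)%E.
Proof.
move=> f1; have fi := Lploc1_integrable a b f1.
have mB : measurable (box a b) by exact: measurable_box.
have mf : measurable_fun (box a b) f by apply: measurable_funTS; case: f1.
have -> : (fun k => \int[mu]_x (f x * bump a b k.+1%:R x)%:E)%E =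
    (fun k => \int[mu]_(x in box a b) (f x * bump a b k.+1%:R x)%:E)%E.
  apply/funext => k; rewrite [RHS]integral_mkcond; apply: eq_integral => x _.
  rewrite patchE; case: ifPn => //; rewrite notin_setE => /bump_out -> //.
  by rewrite mulr0.
apply: (@dominated_cvg _ _ _ mu _ mB
  (fun k x => (f x * bump a b k.+1%:R x)%:E) (EFin \o f) (fun x => `|(f x)%:E|%E)).
- move=> k; apply/measurable_EFinP; apply: measurable_funM => //.
  apply: measurable_funTS; apply: continuous_measurable_rV.
  exact/smooth_continuous/bump_smooth.
- move=> x xab; apply: cvg_EFin; first exact: nearW.
  have := cvgMl_tmp (a := f x) (bump_in xab).
  by rewrite mulr1; apply.
- by [].
- exact: integrable_abse fi.
- move=> k x xab; have /andP[h0 h1] := bump_itv a b k.+1%:R x.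
  by rewrite lee_fin normrM (ger0_norm h0) ler_piMr.
Qed.

Lemma box_integral0 f a b : mu.-integrable (box a b) (EFin \o f) ->
  (forall c d, box c d `<=` box a b -> \int[mu]_(x in box c d) (f x)%:E = 0)%E ->
  {ae mu, forall x, box a b x -> f x = 0}.
Proof.
move=> fi f0.
have mB : measurable (box a b) by exact: measurable_box.
(* Dynkin induction on [E]. For a box [E] the intersection is again a box contained in [box a b];
   complements use that the integral over all of [box a b] is 0, and disjoint unions use countable
   additivity. *)
have step E : measurable E -> (\int[mu]_(x in box a b `&` E) (f x)%:E = 0)%E.
  rewrite measurable_boxesE; apply: (dynkin_induction
    (P := fun E => \int[mu]_(x in box a b `&` E) (f x)%:E = 0)%E
    measurable_boxesE boxes_setI).
  - by rewrite setIT f0.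
  - move=> B Bbox.
    have [c [d cd]] := boxes_setI (ex_intro _ a (ex_intro _ b erefl)) Bbox.
    by rewrite cd f0// -cd.
  - move=> S mS S0.
    have := f0 a b (@subset_refl _ _).
    rewrite -{1}(setIT (box a b)) -(setUv S) setIUr integral_setU//=.
    + by rewrite S0 add0e.
    + exact: measurableI.
    + by apply: measurableI => //; exact: measurableC.
    + rewrite -setIUr setUv setIT; exact: measurable_int fi.
    + by apply/disj_setPRL => x [_ Sx] [].
  - move=> F mF tF F0; rewrite setI_bigcupr integral_bigcup.
    + by apply: eseries0 => i _ _; exact: F0.
    + exact: trivIset_setIl.
    + by move=> k; exact: measurableI.
    + rewrite -setI_bigcupr; apply: integrableS fi => //.
      by apply: measurableI => //; exact: bigcup_measurable.
have : ae_eq mu (box a b) (EFin \o f) (cst 0%E).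
  apply: integral_ae_eq => // E Eab mE.
  by rewrite integral0 -(setIidr Eab) step.
by apply: filterS => x h /h [].
Qed.

Lemma fundamental_lemma f : Lploc 1 f ->
  (forall psi, smooth psi -> compactly_supported psi ->
    \int[mu]_x (f x * psi x) = 0) ->
  {ae mu, forall x, f x = 0}.
Proof.
move=> f1 f0.
have box0 a b : (\int[mu]_(x in box a b) (f x)%:E = 0)%E.
  apply: (cvg_unique _ (bump_integral_cvg f1)) => //.
  rewrite (_ : (fun k => _) = cst 0%E); first exact: cvg_cst.
  apply/funext => k; have bs := bump_smooth a b k.+1%:R.
  have bc : compactly_supported (bump a b k.+1%:R) by exact: bump_compactly_supported.
  (* The hypothesis [f0] concerns the real-valued integral, obtained through [fine], which maps
     infinite values to 0. Finiteness is what carries it over to the extended integral. *)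
  rewrite -[LHS]fineK; first by congr EFin; exact: f0.
  apply: integrable_fin_num => //; apply: Lploc1_integrableM => //.
  exact: smooth_continuous.
(* Countably many cubes cover the space, so the exceptional null sets can be united. *)
have h k : {ae mu, forall x, @cube R n k%:R x -> f x = 0}.
  by apply: box_integral0 => //; exact: Lploc1_integrable.
have := ae_foralln h; apply: filterS => x hx.
by apply: (hx (Num.trunc `|x|).+1); apply: cubeP; exact: truncnS_gt.
Qed.

End fundamental_lemma.

(** * Uniqueness and linearity of weak gradients *)

Section weak_gradient.
Context {R : realType} {n : nat}.
Local Notation mu := (@lebesgue_rV R n).
Implicit Types (x a b : 'rV[R]_n) (u v f psi : 'rV[R]_n -> R^o).
Implicit Types g h : 'rV[R]_n -> 'rV[R]_n.

Lemma Lploc1_lin (s t : R) f1 f2 : Lploc 1 f1 -> Lploc 1 f2 ->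
  Lploc 1 (fun x => s * f1 x + t * f2 x).
Proof.
move=> L1 L2; have [m1 _] := L1; have [m2 _] := L2.
apply: LplocP => [|a b].
  by apply: measurable_funD; exact: measurable_funM.
have mB : measurable (box a b) by exact: measurable_box.
exists ((fun x => s%:E * (EFin \o f1) x) \+ (fun x => t%:E * (EFin \o f2) x))%E.
  by apply: integrableD => //; apply: integrableZl => //; exact: Lploc1_integrable.
by move=> x _; rewrite expr1.
Qed.

Lemma Rintegral_lin (s t : R) f1 f2 psi : Lploc 1 f1 -> Lploc 1 f2 ->
  continuous psi -> compactly_supported psi ->
  \int[mu]_x ((s * f1 x + t * f2 x) * psi x) =
  s * \int[mu]_x (f1 x * psi x) + t * \int[mu]_x (f2 x * psi x).
Proof.
move=> L1 L2 cpsi spsi.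
have i1 := Lploc1_integrableM L1 cpsi spsi.
have i2 := Lploc1_integrableM L2 cpsi spsi.
rewrite -!RintegralZl// -RintegralD//; last 2 first.
- exact: integrableZl i1.
- exact: integrableZl i2.
by apply: eq_Rintegral => x _; rewrite mulrDl !mulrA.
Qed.

(** The defining identity is linear in the pair formed by the function and its gradient; local
    integrability makes both sides split into sums of convergent integrals. *)
Lemma weak_gradient_lin (s t : R) u v g h : Lploc 1 u -> Lploc 1 v ->
  weak_gradient u g -> weak_gradient v h ->
  weak_gradient (fun x => s * u x + t * v x) (fun x => s *: g x + t *: h x).
Proof.
move=> Lu Lv [Lg ug] [Lh vh].
have E i : (fun x => (s *: g x + t *: h x) ord0 i) =
    (fun x => s * g x ord0 i + t * h x ord0 i).
  by apply/funext => x; rewrite !mxE.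
split=> [i|psi smpsi spsi i]; first by rewrite E; exact: Lploc1_lin.
have cpsi := smooth_continuous smpsi.
rewrite Rintegral_lin//; last 2 first.
- exact/smooth_continuous/smooth_partial.
- exact: compactly_supported_partial.
rewrite ug// vh//.
under [in RHS]eq_Rintegral => x _ do rewrite !mxE.
by rewrite Rintegral_lin// !mulrN opprD.
Qed.

Lemma weak_gradient_unique u g h : weak_gradient u g -> weak_gradient u h ->
  {ae mu, forall x, g x = h x}.
Proof.
move=> [Lg ug] [Lh uh].
(* The difference is written with coefficients 1 and -1 so that the linear combination lemmas
   apply. *)
have E i : {ae mu, forall x, 1 * g x ord0 i + (-1) * h x ord0 i = 0}.
  apply: fundamental_lemma; first exact: Lploc1_lin.
  move=> psi smpsi spsi; rewrite Rintegral_lin//; last exact: smooth_continuous.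
  have := ug _ smpsi spsi i; rewrite (uh _ smpsi spsi i) => /oppr_inj ->.
  by rewrite mul1r mulN1r subrr.
apply: filterS (filter_forall _ E) => x gh.
by apply/rowP => i; apply/eqP; rewrite -subr_eq0 -(gh i) mul1r mulN1r.
Qed.

Lemma Lploc_ae p f1 f2 : measurable_fun setT f2 ->
  {ae mu, forall x, f1 x = f2 x} -> Lploc p f1 -> Lploc p f2.
Proof.
move=> m2 f12 [m1 L1]; split=> // a b.
have mB : measurable (box a b) by exact: measurable_box.
suff <- : (\int[mu]_(x in box a b) (`|f1 x| ^+ p)%:E =
    \int[mu]_(x in box a b) (`|f2 x| ^+ p)%:E)%E by exact: L1.
apply: ge0_ae_eq_integral => //.
- apply/measurable_EFinP; apply: measurable_funX; apply: measurableT_comp => //.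
  exact: measurable_funTS.
- apply/measurable_EFinP; apply: measurable_funX; apply: measurableT_comp => //.
  exact: measurable_funTS.
- by apply: filterS f12 => x ->.
Qed.

(** Membership provides some weak gradient with [L^p] components, while [grad u] is a possibly
    different choice; uniqueness almost everywhere transfers the integrability to it. *)
Lemma W1p_perP p a b u : W1p_per p.+1 a b u ->
  [/\ Lploc p.+1 u, weak_gradient u (grad u) &
      forall i, Lploc p.+1 (fun x => grad u x ord0 i)].
Proof.
move=> [_ Lu [g ug Lg]].
have gu : weak_gradient u (grad u) by apply: xgetPex; exists g.
split=> // i; apply: Lploc_ae (Lg i); first by case: gu => /(_ i)[].
by have := weak_gradient_unique ug gu; apply: filterS => x ->.
Qed.

End weak_gradient.

(** * Convexity of the energy density *)

Section energy_density.
Context {R : realType} {n : nat}.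
Implicit Types (v w : 'rV[R]_n) (A s r t : R).

(** The integrand of [calH], with [s] for the value of the function and [r] for the Euclidean norm
    of its gradient. *)
Definition density A s r : R := A * (s ^+ 4 + r ^+ 4) + 3 * s ^+ 2 * r ^+ 2.

Lemma sqr_convex t s r : 0 <= t <= 1 ->
  (t * s + (1 - t) * r) ^+ 2 <= t * s ^+ 2 + (1 - t) * r ^+ 2.
Proof.
move=> /andP[t0 t1]; rewrite -subr_ge0.
rewrite (_ : _ - _ = t * (1 - t) * (s - r) ^+ 2); last by ring.
by rewrite mulr_ge0 ?sqr_ge0// mulr_ge0// subr_ge0.
Qed.

(** The square is convex, and increasing on nonnegative reals, so its composition with itself is
    convex. *)
Lemma expr4_convex t s r : 0 <= t <= 1 ->
  (t * s + (1 - t) * r) ^+ 4 <= t * s ^+ 4 + (1 - t) * r ^+ 4.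
Proof.
move=> t01; have := t01 => /andP[t0 t1].
rewrite !(exprM _ 2 2); apply: le_trans (sqr_convex _ _ t01).
rewrite ler_sqr ?nnegrE ?sqr_ge0//; first exact: sqr_convex.
by rewrite addr_ge0// mulr_ge0 ?sqr_ge0// subr_ge0.
Qed.

(* density A s r = (A - 1/2) (s^4 + r^4) + ((s + r)^4 + (s - r)^4) / 4 *)
Lemma density_convex A t s r s' r' : 1 <= A -> 0 <= t <= 1 ->
  density A (t * s + (1 - t) * s') (t * r + (1 - t) * r') <=
  t * density A s r + (1 - t) * density A s' r'.
Proof.
move=> A1 t01.
have E x y : density A x y =
    (A - 1/2) * (x ^+ 4 + y ^+ 4) + ((x + y) ^+ 4 + (x - y) ^+ 4) / 4.
  by rewrite /density; field.
have h1 := expr4_convex s s' t01.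
have h2 := expr4_convex r r' t01.
have h3 := expr4_convex (s + r) (s' + r') t01.
have h4 := expr4_convex (s - r) (s' - r') t01.
(* The coefficient [A - 1/2] is positive, and the other factor is the sum of the gaps in [h1] and
   [h2]. With this product at hand, the conclusion is linear in [h3], [h4] and [h5]. *)
have h5 : 0 <= (A - 1/2) * (t * s ^+ 4 + (1 - t) * s' ^+ 4 - (t * s + (1 - t) * s') ^+ 4 +
  (t * r ^+ 4 + (1 - t) * r' ^+ 4 - (t * r + (1 - t) * r') ^+ 4)).
  apply: mulr_ge0; first lra.
  by apply: addr_ge0; rewrite subr_ge0.
rewrite !E.
have -> : t * s + (1 - t) * s' + (t * r + (1 - t) * r') =
    t * (s + r) + (1 - t) * (s' + r') by ring.
have -> : t * s + (1 - t) * s' - (t * r + (1 - t) * r') =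
    t * (s - r) + (1 - t) * (s' - r') by ring.
lra.
Qed.

Lemma density_homo A s r r' : 0 <= A -> 0 <= r -> r <= r' ->
  density A s r <= density A s r'.
Proof.
move=> A0 r0 rr'; have r'0 := le_trans r0 rr'.
apply: lerD.
  by rewrite ler_wpM2l// lerD2l lerXn2r// nnegrE.
by apply: ler_wpM2l; [rewrite mulr_ge0 ?sqr_ge0|rewrite lerXn2r// nnegrE].
Qed.

Lemma enorm_ge0 v : 0 <= enorm v.
Proof. exact: sqrtr_ge0. Qed.

Lemma sqr_enorm v : enorm v ^+ 2 = \sum_(i < n) v ord0 i ^+ 2.
Proof. by rewrite sqr_sqrtr// sumr_ge0// => i _; exact: sqr_ge0. Qed.

(** The sum of the squares [(|w| v_i - |v| w_i)^2] equals [2 |v| |w| (|v| |w| - <v, w>)]; dividing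
    by [|v| |w|] requires treating a zero vector first. *)
Lemma cauchy_schwarz v w :
  \sum_(i < n) v ord0 i * w ord0 i <= enorm v * enorm w.
Proof.
have [vw0|] := eqVneq (enorm v * enorm w) 0.
  rewrite vw0 big1// => i _.
  have z (z : 'rV[R]_n) : enorm z = 0 -> z ord0 i = 0.
    move=> /(congr1 (fun r => r ^+ 2)); rewrite sqr_enorm expr0n/= => /eqP.
    rewrite psumr_eq0 => [/allP/(_ i (mem_index_enum i))|j _]; last exact: sqr_ge0.
    by rewrite /= sqrf_eq0 => /eqP.
  by move: vw0 => /eqP; rewrite mulf_eq0 => /orP[] /eqP/z ->; rewrite ?mul0r ?mulr0.
move=> vw0; have vw : 0 < enorm v * enorm w.
  by rewrite lt_def vw0 mulr_ge0// enorm_ge0.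
have : 0 <= \sum_(i < n) (enorm w * v ord0 i - enorm v * w ord0 i) ^+ 2.
  by apply: sumr_ge0 => i _; exact: sqr_ge0.
rewrite (_ : \sum_(i < n) _ = enorm w ^+ 2 * (\sum_(i < n) v ord0 i ^+ 2) +
   enorm v ^+ 2 * (\sum_(i < n) w ord0 i ^+ 2) -
   2 * (enorm v * enorm w) * \sum_(i < n) v ord0 i * w ord0 i); last first.
  rewrite !mulr_sumr -big_split -sumrB; apply: eq_bigr => i _ /=; ring.
rewrite -!sqr_enorm => h.
rewrite -(ler_pM2l vw); lra.
Qed.

(** Both sides are nonnegative, so their squares may be compared; these differ only in the cross
    term, controlled by [cauchy_schwarz]. *)
Lemma enorm_convex t v w : 0 <= t <= 1 ->
  enorm (t *: v + (1 - t) *: w) <= t * enorm v + (1 - t) * enorm w.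
Proof.
move=> /andP[t0 t1]; have t1' : 0 <= 1 - t by rewrite subr_ge0.
rewrite -ler_sqr ?nnegrE ?enorm_ge0//; last by rewrite addr_ge0// mulr_ge0// enorm_ge0.
have -> : (t * enorm v + (1 - t) * enorm w) ^+ 2 = t ^+ 2 * enorm v ^+ 2 +
  (1 - t) ^+ 2 * enorm w ^+ 2 + 2 * (t * (1 - t)) * (enorm v * enorm w) by ring.
rewrite (_ : enorm (t *: v + _) ^+ 2 = t ^+ 2 * enorm v ^+ 2 +
  (1 - t) ^+ 2 * enorm w ^+ 2 + 2 * (t * (1 - t)) * \sum_(i < n) v ord0 i * w ord0 i).
  by rewrite lerD2l; apply: ler_wpM2l; [rewrite !mulr_ge0|exact: cauchy_schwarz].
rewrite !sqr_enorm !mulr_sumr -!big_split; apply: eq_bigr => i _ /=.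
by rewrite !mxE; ring.
Qed.

Lemma energy_convex A t s s' v w : 1 <= A -> 0 <= t <= 1 ->
  density A (t * s + (1 - t) * s') (enorm (t *: v + (1 - t) *: w)) <=
  t * density A s (enorm v) + (1 - t) * density A s' (enorm w).
Proof.
move=> A1 t01; apply: le_trans (density_convex _ _ _ _ A1 t01).
apply: density_homo; [exact: le_trans A1|exact: enorm_ge0|exact: enorm_convex].
Qed.

Lemma density_ge0 A s r : 0 <= A -> 0 <= density A s r.
Proof.
have ge4 (x : R) : 0 <= x ^+ 4 by rewrite (exprM _ 2 2) sqr_ge0.
move=> A0; apply: addr_ge0; first by rewrite mulr_ge0// addr_ge0.
by rewrite mulr_ge0 ?sqr_ge0// mulr_ge0 ?sqr_ge0.
Qed.

Lemma density_le A s v : 0 <= A -> density A s (enorm v) <=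
  (A + 2) * (`|s| ^+ 4 + n%:R * \sum_(i < n) `|v ord0 i| ^+ 4).
Proof.
move=> A0.
have n4 (r : R) : `|r| ^+ 4 = r ^+ 4.
  by rewrite (exprM _ 2 2) -normrX ger0_norm ?sqr_ge0// -exprM.
(* Expand [(sum v_i^2)^2] as a double sum and bound [v_i^2 v_j^2] by [(v_i^4 + v_j^4) / 2]; each
   half contributes [n/2] times the sum of fourth powers. *)
have S4 : enorm v ^+ 4 <= n%:R * \sum_(i < n) `|v ord0 i| ^+ 4.
  rewrite (exprM _ 2 2) sqr_enorm expr2 big_distrlr/=.
  apply: (@le_trans _ _ (\sum_(i < n) \sum_(j < n) (v ord0 i ^+ 4 + v ord0 j ^+ 4) / 2)).
    apply: ler_sum => i _; apply: ler_sum => j _.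
    have := sqr_ge0 (v ord0 i ^+ 2 - v ord0 j ^+ 2); lra.
  have -> : \sum_(i < n) \sum_(j < n) (v ord0 i ^+ 4 + v ord0 j ^+ 4) / 2 =
      (\sum_(i < n) \sum_(j < n) v ord0 i ^+ 4 +
       \sum_(i < n) \sum_(j < n) v ord0 j ^+ 4) / 2.
    rewrite -big_split/= mulr_suml; apply: eq_bigr => i _.
    by rewrite -big_split/= mulr_suml.
  rewrite [X in _ + X]exchange_big/=.
  have -> : \sum_(i < n) \sum_(j < n) v ord0 i ^+ 4 =
      n%:R * \sum_(i < n) `|v ord0 i| ^+ 4.
    rewrite mulr_sumr; apply: eq_bigr => i _.
    by rewrite sumr_const card_ord n4 mulr_natl.
  lra.
(* Since [2 s^2 r^2 <= s^4 + r^4], the mixed term costs at most [3/2], rounded up to 2. *)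
apply: (@le_trans _ _ ((A + 2) * (s ^+ 4 + enorm v ^+ 4))).
  have := sqr_ge0 (s ^+ 2 - enorm v ^+ 2).
  have : 0 <= s ^+ 4 by rewrite (exprM _ 2 2) sqr_ge0.
  have : 0 <= enorm v ^+ 4 by rewrite (exprM _ 2 2) sqr_ge0.
  rewrite /density; lra.
by rewrite n4 ler_wpM2l ?lerD2l// addr_ge0.
Qed.

End energy_density.

(** * The energy *)

Section energy.
Context {R : realType} {n : nat}.
Local Notation mu := (@lebesgue_rV R n).
Implicit Types (u : 'rV[R]_n -> R^o) (g : 'rV[R]_n -> 'rV[R]_n).

Lemma measurable_density A u g : measurable_fun setT u ->
  (forall i, measurable_fun setT (fun x => g x ord0 i)) ->
  measurable_fun setT (fun x => density A (u x) (enorm (g x))).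
Proof.
move=> mu_ mg.
have ms : measurable_fun setT (fun x => enorm (g x) ^+ 2).
  under eq_fun do rewrite sqr_enorm.
  by apply: measurable_sum => i; exact: measurable_funX.
(* The norm then occurs only through its square, a polynomial in the components, so the square root
   needs no measurability argument. *)
have -> : (fun x => density A (u x) (enorm (g x))) =
    (fun x => A * (u x ^+ 4 + (enorm (g x) ^+ 2) ^+ 2) + 3 * u x ^+ 2 * enorm (g x) ^+ 2).
  by apply/funext => x; rewrite /density -exprM.
apply: measurable_funD; apply: measurable_funM => //.
  by apply: measurable_funD; exact: measurable_funX.
by apply: measurable_funM => //; exact: measurable_funX.
Qed.

Lemma density_integrable A a b u g : 0 <= A -> Lploc 4 u ->
  (forall i, Lploc 4 (fun x => g x ord0 i)) ->
  mu.-integrable (box a b) (EFin \o (fun x => density A (u x) (enorm (g x)))).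
Proof.
move=> A0 Lu Lg; have mB : measurable (box a b) by exact: measurable_box.
have m : measurable_fun setT (fun x => density A (u x) (enorm (g x))).
  by apply: measurable_density => [|i]; [case: Lu|case: (Lg i)].
have i1 := Lploc_integrable a b Lu.
have i2 : mu.-integrable (box a b)
    (fun x => \sum_(i < n) (`|g x ord0 i| ^+ 4)%:E)%E.
  by apply: integrable_sum => // i _; exact: (Lploc_integrable a b (Lg i)).
have i3 := integrableZl mB (A + 2) (integrableD mB i1 (integrableZl mB n%:R i2)).
apply: le_integrable i3 => //; first by apply/measurable_EFinP; exact: measurable_funTS.
move=> x _ /=; rewrite sumEFin.
rewrite -[leRHS]/(`|(A + 2) * (`|u x| ^+ 4 + n%:R * \sum_(i < n) `|g x ord0 i| ^+ 4)|%:E).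
rewrite lee_fin.
rewrite ger0_norm ?density_ge0//; apply: le_trans (density_le _ _ A0) _.
exact: ler_norm.
Qed.

End energy.

Theorem lemma2p2 (R : realType) (D : nat) (hD : D = 2%N \/ D = 3%N)
    (a b : 'rV[R]_D) (hab : forall i : 'I_D, a ord0 i < b ord0 i)
    (A : R) (hA : 1 <= A) :
  convex_function (W1p_per 4 a b) (calH A a b).
Proof.
move=> t u v /set_mem Wu /set_mem Wv.
have [Lu ugu Lgu] := W1p_perP Wu; have [Lv vgv Lgv] := W1p_perP Wv.
have A0 : 0 <= A := le_trans ler01 hA.
have t01 : 0 <= t%:num <= 1 by rewrite ge0 le1.
have mB : measurable (box a b) by exact: measurable_box.
have iu := density_integrable a b A0 Lu Lgu.
have iv := density_integrable a b A0 Lv Lgv.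
pose s := t%:num; pose w x := s * u x + (1 - s) * v x.
pose g x := s *: grad u x + (1 - s) *: grad v x.
have wg : weak_gradient w g.
  by apply: weak_gradient_lin; [exact: Lploc_le1 Lu|exact: Lploc_le1 Lv| |].
(* The witness [g] guarantees that the choice [grad w] is a genuine weak gradient and not the
   default value 0. *)
have wgw : weak_gradient w (grad w) by apply: xgetPex; exists g.
have gw := weak_gradient_unique wgw wg.
have [mu_ _] := Lu; have [mv_ _] := Lv.
have mw : measurable_fun setT w.
  by apply: measurable_funD; exact: measurable_funM.
have mg h : weak_gradient w h ->
    measurable_fun setT (fun x => density A (w x) (enorm (h x))).
  by move=> [Lh _]; apply: measurable_density => // i; case: (Lh i).
have dw x : density A (w x) (enorm (g x)) <=
    s * density A (u x) (enorm (grad u x)) + (1 - s) * density A (v x) (enorm (grad v x)).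
  exact: energy_convex.
have isu := integrableZl mB s iu.
have isv := integrableZl mB (1 - s) iv.
have iuv := integrableD mB isu isv.
(* The density is nonnegative, so the pointwise convexity bound [dw] also serves as domination. *)
have iw : (lebesgue_rV D).-integrable (box a b)
    (EFin \o (fun x => density A (w x) (enorm (g x)))).
  apply: le_integrable iuv => //.
    by apply/measurable_EFinP/measurable_funTS; exact: mg.
  move=> x _ /=; rewrite lee_fin ger0_norm ?density_ge0//.
  exact: le_trans (dw x) (ler_norm _).
rewrite -[conv t u v]/w convRE.
(* The chosen [grad w] agrees with [g] only almost everywhere, which suffices under the integral;
   the pointwise bound [dw] is then integrated. *)
have -> : calH A a b w = \int[lebesgue_rV D]_(x in box a b) density A (w x) (enorm (g x)).
  congr fine; apply: ae_eq_integral => //.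
  - by apply/measurable_EFinP/measurable_funTS; exact: mg.
  - by apply/measurable_EFinP/measurable_funTS; exact: mg.
  - by apply: filterS gw => x -> .
rewrite /calH -/(density _ _ _) -!RintegralZl// -RintegralD//.
exact: le_Rintegral.
Qed.
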